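(* For every integer $q_0>1$, the construction described in the context terminates: there is an integer $N\ge 1$ such that $A_n>0$ for $1\le n\le N$ and $A_{N+1}=0$. The resulting numbers $q_1,\dots,q_N$ are positive integers, $\delta_n\in\{1,-1\}$ for $1\le n\le N$, and $$\frac{\pi}{4}= m\arctan\frac{1}{q_0}+\sum_{n=1}^{N}\delta_n\arctan\frac{1}{q_n}.$$
   Context: For real $x$, $\lfloor x\rceil$ denotes the nearest integer to $x$, with exact halves rounded up; $\operatorname{sign}(x)\in\{-1,0,1\}$ is the usual sign function. Construction. Let $q_0>1$ be an integer. Put $m=\left\lfloor \frac{\pi/4}{\arctan(1/q_0)}\right\rceil$. Define integers $a_k,b_k$ by $a_0=b_0=1$ and, for $k\ge 0$, $a_{k+1}=q_0a_k-b_k$, $b_{k+1}=q_0b_k+a_k$. Put $A_1=|a_m|$, $B_1=b_m$, $\delta_1=\operatorname{sign}(a_m)$. For $n\ge 1$, as long as $A_n>0$, define $$q_n=\left\lfloor \frac{B_n}{A_n}\right\rceil,\qquad A_{n+1}=|q_nA_n-B_n|,\qquad B_{n+1}=q_nB_n+A_n,\qquad \delta_{n+1}=\delta_n\operatorname{sign}(q_nA_n-B_n).$$ The construction stops as soon as $A_{n+1}=0$. *)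

(* Defs.v *)
From Stdlib Require Import Reals ZArith Zfloor.

Open Scope R_scope.

(* Nearest integer, exact halves rounded up. *)
Definition nearest (x : R) : Z := Zfloor (x + 1 / 2).

Definition machin_m (q0 : Z) : Z := nearest ((PI / 4) / atan (1 / IZR q0)).

Fixpoint machin_ab (q0 : Z) (k : nat) : Z * Z :=
  match k with
  | O => (1, 1)%Z
  | S k' => let (a, b) := machin_ab q0 k' in (q0 * a - b, q0 * b + a)%Z
  end.

Definition machin_a (q0 : Z) (k : nat) : Z := fst (machin_ab q0 k).
Definition machin_b (q0 : Z) (k : nat) : Z := snd (machin_ab q0 k).

Record machin_state : Set := MachinState { stA : Z; stB : Z; stDelta : Z }.

Definition state_q (s : machin_state) : Z := nearest (IZR (stB s) / IZR (stA s)).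

(* [Z.to_nat] loses nothing here: [machin_m q0] is nonnegative for [q0 > 1]. *)
Definition machin_init (q0 : Z) : machin_state :=
  let m := Z.to_nat (machin_m q0) in
  MachinState (Z.abs (machin_a q0 m)) (machin_b q0 m) (Z.sgn (machin_a q0 m)).

Definition machin_step (s : machin_state) : machin_state :=
  let q := state_q s in
  MachinState (Z.abs (q * stA s - stB s))
              (q * stB s + stA s)
              (stDelta s * Z.sgn (q * stA s - stB s)).

(* The state after [k] steps, that is (A_{k+1}, B_{k+1}, delta_{k+1}).  The
   recursion is total: it goes on with meaningless values once A has become 0,
   so only the states up to and including the first one with A = 0 belong to
   the construction. *)
Fixpoint machin_iter (q0 : Z) (k : nat) : machin_state :=
  match k with
  | O => machin_init q0
  | S k' => machin_step (machin_iter q0 k')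
  end.

(* These sequences are indexed from 1; their values at 0 are meaningless. *)
Definition machin_A (q0 : Z) (n : nat) : Z := stA (machin_iter q0 (n - 1)).
Definition machin_B (q0 : Z) (n : nat) : Z := stB (machin_iter q0 (n - 1)).
Definition machin_delta (q0 : Z) (n : nat) : Z := stDelta (machin_iter q0 (n - 1)).
Definition machin_q (q0 : Z) (n : nat) : Z := state_q (machin_iter q0 (n - 1)).

(* Main.v *)
Require Import Defs.
From Stdlib Require Import Reals ZArith Zfloor.
From Stdlib Require Import Lra Lia Znumtheory Zpow_facts Machin.

(** The construction is multiplication of Gaussian integers.  Write an integer
    pair (a, b) as z = b + i a.  Then (a, b) |-> (q a - b, q b + a) is
    z |-> z (q - i), which turns z by the angle - arctan (1/q), and replacing a
    by its absolute value conjugates z when a is negative; the signs delta keep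
    track of the conjugations.  So each step splits arctan (1/q) off the
    remaining angle, and the formula is complete when the remaining angle is 0,
    that is, when z is real ([atan_rotate], [machin_step_angle]).

    The process stops because q_n is the integer nearest to B_n / A_n: the new
    A is at most half of the old one ([machin_step_A_half]).

    The start z = (1+i) (q0 - i)^m has angle pi/4 - m arctan (1/q0), which is at
    most half of arctan (1/q0) in absolute value by the choice of m.  Hence
    |a_m| < b_m ([machin_ab_at_m]).  That a_m is not 0 is arithmetic: the a_k
    satisfy a recurrence of order two which modulo q0^2 + 1 reads
    a_{k+2} = 2 q0 a_{k+1}, so a_{k+1} is congruent to (2 q0)^k (q0 - 1).  The
    odd part of q0^2 + 1 is prime to 2 q0 and exceeds q0 - 1, so it cannot
    divide that number ([machin_a_neq_0]). *)

Open Scope R_scope.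

(** * Rounding *)

Lemma nearest_bound x : IZR (nearest x) - 1 / 2 <= x < IZR (nearest x) + 1 / 2.
Proof.
unfold nearest. pose proof (Zfloor_bound (x + 1 / 2)). lra.
Qed.

Lemma nearest_lub (z : Z) x : IZR z <= x + 1 / 2 -> (z <= nearest x)%Z.
Proof. apply Zfloor_lub. Qed.

(** * Turning a Gaussian integer by arctan (1/q) *)

Lemma atan_pos x : 0 < x -> 0 < atan x.
Proof. intros Hx. rewrite <- atan_0. now apply atan_increasing. Qed.

Lemma atan_pos_inv x : 0 < atan x -> 0 < x.
Proof.
intros Hx. destruct (Rlt_le_dec 0 x) as [| [Hneg | ->]]; trivial.
- apply atan_increasing in Hneg. rewrite atan_0 in Hneg. lra.
- rewrite atan_0 in Hx. lra.
Qed.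

(** The argument of (b + i a) (q - i).  For nonnegative a both angles on the
    left lie in [0, pi/2), so their difference needs no multiple of pi. *)
Lemma atan_rotate (q a b : Z) : (0 < q)%Z -> (0 <= a)%Z -> (0 < b)%Z ->
  atan (IZR a / IZR b) - atan (1 / IZR q)
  = atan (IZR (q * a - b) / IZR (q * b + a)).
Proof.
intros Hq Ha Hb.
apply IZR_lt in Hq. apply IZR_le in Ha. apply IZR_lt in Hb.
rewrite minus_IZR, plus_IZR, !mult_IZR.
assert (Hu : 0 <= IZR a / IZR b) by (apply Rle_mult_inv_pos; assumption).
assert (Hv : 0 < 1 / IZR q) by (apply Rdiv_lt_0_compat; lra).
assert (Hu' : 0 <= atan (IZR a / IZR b)).
{ destruct Hu as [Hu | <-]; [left; now apply atan_pos | rewrite atan_0; lra]. }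
pose proof (atan_pos _ Hv) as Hv'.
pose proof (atan_bound (IZR a / IZR b)). pose proof (atan_bound (1 / IZR q)).
rewrite (atan_sub_correct (IZR a / IZR b) (1 / IZR q)).
- replace (atan_sub (IZR a / IZR b) (1 / IZR q))
    with ((IZR q * IZR a - IZR b) / (IZR q * IZR b + IZR a)); [lra |].
  unfold atan_sub. field. repeat split; nra.
- nra.
- lra.
- apply atan_bound.
Qed.

(** * The reduction steps *)

(** A state is reduced if B + i A has its argument in (0, pi/4]; this is what
    makes the next quotient positive. *)
Definition reduced (s : machin_state) : Prop :=
  (0 < stA s <= stB s)%Z /\ (stDelta s = 1 \/ stDelta s = -1)%Z.

Definition state_angle (s : machin_state) : R :=
  IZR (stDelta s) * atan (IZR (stA s) / IZR (stB s)).

Lemma state_q_pos s : reduced s -> (0 < state_q s)%Z.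
Proof.
intros [[HA HAB] _].
cut (1 <= state_q s)%Z; [lia |]. apply nearest_lub.
apply IZR_lt in HA. apply IZR_le in HAB.
cut (1 <= IZR (stB s) / IZR (stA s)); [lra |].
apply Rmult_le_reg_r with (IZR (stA s)); trivial.
replace (IZR (stB s) / IZR (stA s) * IZR (stA s)) with (IZR (stB s)); [lra |].
field. lra.
Qed.

Lemma machin_step_A_half s : (0 < stA s)%Z ->
  (2 * stA (machin_step s) <= stA s)%Z.
Proof.
intros HA. cbn [machin_step stA].
pose proof (nearest_bound (IZR (stB s) / IZR (stA s))) as [H1 H2].
fold (state_q s) in H1, H2.
set (q := state_q s) in *. apply IZR_lt in HA.
assert (E : IZR (stB s) = IZR (stB s) / IZR (stA s) * IZR (stA s)).
{ field. lra. }
assert (L : (2 * (q * stA s - stB s) <= stA s)%Z).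
{ apply le_IZR. rewrite mult_IZR, minus_IZR, mult_IZR. nra. }
assert (U : (- stA s <= 2 * (q * stA s - stB s))%Z).
{ apply le_IZR. rewrite opp_IZR, mult_IZR, minus_IZR, mult_IZR. nra. }
lia.
Qed.

Lemma machin_step_A_nonneg s : (0 <= stA (machin_step s))%Z.
Proof. apply Z.abs_nonneg. Qed.

Lemma machin_step_reduced s :
  reduced s -> stA (machin_step s) <> 0%Z -> reduced (machin_step s).
Proof.
intros Hs Hnz. pose proof (state_q_pos s Hs) as Hq.
destruct Hs as [HA Hd].
pose proof (machin_step_A_half s (proj1 HA)) as Hhalf.
pose proof (machin_step_A_nonneg s). unfold reduced. split.
- assert (stB s <= stB (machin_step s))%Z by (simpl; nia). lia.
- simpl in *.
  destruct (Z.sgn_spec (state_q s * stA s - stB s)); destruct Hd as [-> | ->]; lia.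
Qed.

Lemma atan_sgn_abs (a : Z) (b : R) :
  IZR (Z.sgn a) * atan (IZR (Z.abs a) / b) = atan (IZR a / b).
Proof.
destruct a as [| p | p]; simpl.
- replace (0 / b) with 0 by (unfold Rdiv; ring). rewrite atan_0. ring.
- ring.
- change (Z.neg p) with (- Z.pos p)%Z. rewrite opp_IZR, Rdiv_opp_l, atan_opp.
  ring.
Qed.

Lemma machin_step_angle s : reduced s ->
  state_angle s
  = IZR (stDelta s) * atan (1 / IZR (state_q s)) + state_angle (machin_step s).
Proof.
intros Hs. pose proof (state_q_pos s Hs) as Hq. destruct Hs as [HA _].
unfold state_angle. simpl.
rewrite mult_IZR, Rmult_assoc, atan_sgn_abs, <- atan_rotate by lia.
ring.
Qed.

(** * The starting point *)

Lemma machin_ab_S q k :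
  machin_a q (S k) = (q * machin_a q k - machin_b q k)%Z /\
  machin_b q (S k) = (q * machin_b q k + machin_a q k)%Z.
Proof.
unfold machin_a, machin_b. simpl. now destruct (machin_ab q k).
Qed.

(** [q - i] is a root of [X^2 - 2 q X + (q^2 + 1)], whence a recurrence
    [a_{k+2} = 2 q a_{k+1} - (q^2 + 1) a_k]. *)
Lemma machin_a_congr q k :
  exists c, machin_a q (S k) = ((2 * q) ^ Z.of_nat k * (q - 1) + (q * q + 1) * c)%Z.
Proof.
induction k as [| k [c IH]].
- exists 0%Z. change (machin_a q 1) with (q * 1 - 1)%Z.
  change (Z.of_nat 0) with 0%Z. rewrite Z.pow_0_r. ring.
- exists (2 * q * c - machin_a q k)%Z.
  destruct (machin_ab_S q (S k)) as [-> _].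
  assert (E : (q * machin_a q (S k) - machin_b q (S k)
               = 2 * q * machin_a q (S k) - (q * q + 1) * machin_a q k)%Z).
  { destruct (machin_ab_S q k) as [-> ->]. ring. }
  rewrite E, IH, Nat2Z.inj_succ, Z.pow_succ_r by lia. ring.
Qed.

(** In the two cases the divisor [u] is the odd part of [q^2 + 1], which is not
    divisible by 4. *)
Lemma machin_a_neq_0 q k : (1 < q)%Z -> machin_a q k <> 0%Z.
Proof.
intros Hq. destruct k as [| k]; [discriminate |]. intros H0.
destruct (machin_a_congr q k) as [c Hc]. rewrite H0 in Hc.
assert (Hu : exists u, (q - 1 < u /\ (u | q * q + 1) /\ rel_prime u (2 * q))%Z).
{ destruct (Z.Even_or_Odd q) as [[r Hr] | [r Hr]]; subst q.
  - exists (2 * r * (2 * r) + 1)%Z. split; [nia | split; [apply Z.divide_refl |]].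
    apply bezout_rel_prime.
    apply Bezout_intro with 1%Z (- r)%Z. ring.
  - exists (2 * r * r + 2 * r + 1)%Z. split; [nia | split].
    + exists 2%Z. ring.
    + apply rel_prime_mult; apply bezout_rel_prime.
      * apply Bezout_intro with 1%Z (- (r * r + r))%Z. ring.
      * (* 2 u - q^2 = 1 *)
        apply Bezout_intro with 2%Z (- (2 * r + 1))%Z. ring. }
destruct Hu as (u & Hlt & Hdvd & Hrp).
assert (D : (u | (2 * q) ^ Z.of_nat k * (q - 1))%Z).
{ replace ((2 * q) ^ Z.of_nat k * (q - 1))%Z with ((q * q + 1) * - c)%Z by lia.
  now apply Z.divide_mul_l. }
apply Gauss in D; [| apply rel_prime_Zpower_r; [lia | exact Hrp]].
apply Z.divide_pos_le in D; lia.
Qed.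

Lemma theta_bound (q : Z) : (1 < q)%Z -> 0 < atan (1 / IZR q) < PI / 4.
Proof.
intros Hq. apply IZR_lt in Hq. split.
- apply atan_pos, Rdiv_lt_0_compat; lra.
- rewrite <- atan_1. apply atan_increasing.
  apply Rmult_lt_reg_r with (IZR q); [lra |].
  replace (1 / IZR q * IZR q) with 1 by (field; lra). lra.
Qed.

Lemma machin_m_bound (q : Z) : (1 < q)%Z ->
  (0 <= machin_m q)%Z /\
  Rabs (PI / 4 - IZR (machin_m q) * atan (1 / IZR q)) <= atan (1 / IZR q) / 2.
Proof.
intros Hq. destruct (theta_bound q Hq) as [H0 H1].
set (t := atan (1 / IZR q)) in *.
assert (E : PI / 4 = PI / 4 / t * t) by (field; lra).
split.
- apply nearest_lub. fold t.
  cut (0 < PI / 4 / t); [simpl; lra |]. apply Rdiv_lt_0_compat; lra.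
- unfold machin_m. fold t. pose proof (nearest_bound (PI / 4 / t)) as [L U].
  apply Rabs_le. nra.
Qed.

(** As long as some of the angle pi/4 is left before a turn, the number to be
    turned lies in the first quadrant, and [atan_rotate] applies. *)
Lemma machin_ab_angle (q : Z) (k : nat) : (1 < q)%Z ->
  (forall j, (j < k)%nat -> INR j * atan (1 / IZR q) < PI / 4) ->
  (0 < machin_b q k)%Z /\
  PI / 4 = INR k * atan (1 / IZR q) + atan (IZR (machin_a q k) / IZR (machin_b q k)).
Proof.
intros Hq. induction k as [| k IH]; intros Hk.
- split; [reflexivity |]. change (machin_a q 0) with 1%Z.
  change (machin_b q 0) with 1%Z. rewrite <- atan_1.
  replace (1 / 1) with 1 by field. simpl. ring.
- destruct IH as [Hb Hang]; [intros j Hj; apply Hk; lia |].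
  assert (Ha : (0 < machin_a q k)%Z).
  { specialize (Hk k ltac:(lia)).
    pose proof (IZR_lt _ _ Hb) as Hb'. apply lt_IZR.
    assert (P : 0 < IZR (machin_a q k) / IZR (machin_b q k)).
    { apply atan_pos_inv. lra. }
    replace (IZR (machin_a q k))
      with (IZR (machin_a q k) / IZR (machin_b q k) * IZR (machin_b q k))
      by (field; lra).
    now apply Rmult_lt_0_compat. }
  destruct (machin_ab_S q k) as [-> ->]. split; [nia |].
  rewrite S_INR, <- atan_rotate by lia. lra.
Qed.

Lemma machin_ab_at_m (q : Z) : (1 < q)%Z ->
  let m := Z.to_nat (machin_m q) in
  (Z.abs (machin_a q m) < machin_b q m)%Z /\
  PI / 4 = IZR (machin_m q) * atan (1 / IZR q)
           + atan (IZR (machin_a q m) / IZR (machin_b q m)).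
Proof.
intros Hq m.
destruct (theta_bound q Hq) as [T0 T1].
destruct (machin_m_bound q Hq) as [M0 M1].
assert (Em : IZR (machin_m q) = INR m).
{ unfold m. now rewrite INR_IZR_INZ, Z2Nat.id. }
rewrite Em in *.
assert (M2 : - (atan (1 / IZR q) / 2) <= PI / 4 - INR m * atan (1 / IZR q)
             <= atan (1 / IZR q) / 2).
{ revert M1. unfold Rabs. destruct (Rcase_abs _); lra. }
destruct (machin_ab_angle q m Hq) as [Hb Hang].
{ intros j Hj. assert (INR j + 1 <= INR m).
  { rewrite <- S_INR. apply le_INR. lia. }
  nra. }
split; [| exact Hang].
pose proof (IZR_lt _ _ Hb) as Hb'.
set (x := IZR (machin_a q m) / IZR (machin_b q m)) in *.
assert (Ex : IZR (machin_a q m) = x * IZR (machin_b q m)).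
{ unfold x. field. lra. }
clearbody x. pose proof atan_1 as A1.
assert (A2 : atan (-1) = - (PI / 4)) by (rewrite <- A1; apply atan_opp).
assert (X1 : x < 1).
{ destruct (Rlt_le_dec x 1) as [| [H | H]]; trivial.
  - apply atan_increasing in H. lra.
  - rewrite <- H in Hang. lra. }
assert (X2 : - 1 < x).
{ destruct (Rlt_le_dec (-1) x) as [| [H | H]]; trivial.
  - apply atan_increasing in H. lra.
  - rewrite H in Hang. lra. }
assert (U : (machin_a q m < machin_b q m)%Z) by (apply lt_IZR; nra).
assert (L : (- machin_b q m < machin_a q m)%Z).
{ apply lt_IZR. rewrite opp_IZR. nra. }
lia.
Qed.

Lemma machin_init_spec (q : Z) : (1 < q)%Z ->
  reduced (machin_init q) /\
  PI / 4 = IZR (machin_m q) * atan (1 / IZR q) + state_angle (machin_init q).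
Proof.
intros Hq. destruct (machin_ab_at_m q Hq) as [Hab Hang].
pose proof (machin_a_neq_0 q (Z.to_nat (machin_m q)) Hq) as Hnz.
unfold reduced, state_angle, machin_init. simpl. split.
- split; [lia |].
  destruct (Z.sgn_spec (machin_a q (Z.to_nat (machin_m q)))); lia.
- now rewrite atan_sgn_abs.
Qed.

(** * Termination and summation *)

(** The nonnegative integer A bounds the number of steps left.  The induction
    peels steps off the front; [f] is the orbit of the current state. *)
Lemma machin_run (f : nat -> machin_state) :
  (forall k, f (S k) = machin_step (f k)) -> reduced (f O) ->
  exists n : nat,
    (forall k, (k <= n)%nat -> reduced (f k)) /\
    stA (f (S n)) = 0%Z /\
    state_angle (f O)
    = sum_f_R0 (fun k => IZR (stDelta (f k)) * atan (1 / IZR (state_q (f k)))) n.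
Proof.
remember (Z.to_nat (stA (f O))) as bound eqn:Hbound.
revert f Hbound. induction bound as [bound IH] using lt_wf_ind.
intros f Hbound Hstep H0.
pose proof (machin_step_angle _ H0) as Hang.
pose proof (machin_step_reduced _ H0) as H1.
pose proof (machin_step_A_half _ (proj1 (proj1 H0))) as Hhalf.
pose proof (machin_step_A_nonneg (f O)) as Hnn.
rewrite <- Hstep in Hang, H1, Hhalf, Hnn.
destruct (Z.eq_dec (stA (f 1%nat)) 0) as [E | NE].
- exists O. split; [| split; trivial].
  + intros k Hk. now replace k with O by lia.
  + simpl. rewrite Hang. unfold state_angle at 1. rewrite E.
    unfold Rdiv at 2. rewrite Rmult_0_l, atan_0. ring.
- destruct (IH (Z.to_nat (stA (f 1%nat)))) with (f := fun k => f (S k))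
    as (n & Hred & Hend & Hsum); auto.
  { destruct H0 as [? _]. lia. }
  exists (S n). split; [| split; trivial].
  + intros [| k] Hk; [exact H0 | apply Hred; lia].
  + rewrite decomp_sum by lia. simpl pred. rewrite <- Hsum. exact Hang.
Qed.

Theorem mainTheorem1 :
  forall q0 : Z, (1 < q0)%Z ->
  exists N : nat,
    (1 <= N)%nat /\
    (forall n : nat, (1 <= n <= N)%nat -> (0 < machin_A q0 n)%Z) /\
    machin_A q0 (N + 1) = 0%Z /\
    (forall n : nat, (1 <= n <= N)%nat -> (0 < machin_q q0 n)%Z) /\
    (forall n : nat, (1 <= n <= N)%nat ->
       machin_delta q0 n = 1%Z \/ machin_delta q0 n = (-1)%Z) /\
    PI / 4 = IZR (machin_m q0) * atan (1 / IZR q0)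
             + sum_f 1 N (fun n : nat =>
                 IZR (machin_delta q0 n) * atan (1 / IZR (machin_q q0 n))).
Proof.
intros q0 Hq.
destruct (machin_init_spec q0 Hq) as [Hinit Hang].
destruct (machin_run (machin_iter q0)) as (n & Hred & Hend & Hsum);
  [reflexivity | exact Hinit |].
change (machin_iter q0 0) with (machin_init q0) in Hsum.
exists (S n). split; [lia |].
assert (Hr : forall k, (1 <= k <= S n)%nat -> reduced (machin_iter q0 (k - 1))).
{ intros k Hk. apply Hred. lia. }
repeat split.
- intros k Hk. apply (Hr k Hk).
- unfold machin_A. now replace (S n + 1 - 1)%nat with (S n) by lia.
- intros k Hk. apply state_q_pos, (Hr k Hk).
- intros k Hk. apply (Hr k Hk).
- rewrite Hang, Hsum. apply f_equal. unfold sum_f, machin_delta, machin_q.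
  replace (S n - 1)%nat with n by lia.
  apply sum_eq. intros k _. now replace (k + 1 - 1)%nat with k by lia.
Qed.
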